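(* For every positive integer $d$, $$\tau(2a_d+1,\,3)\;\leq\;3^{-d},$$ where $a_d$ is the maximum size of a cap in the affine geometry $AG(d,3)$.
   Context: A cap in $AG(d,3)$ is a subset of $\mathbb{Z}_3^d$ containing no three distinct points on a line; equivalently, no three distinct elements of it sum to zero. A $3$-graph is a pair $H=(V(H),E(H))$ where $V(H)$ is a finite set of vertices and $E(H)$ is a collection of $3$-subsets of $V(H)$. The independence number $\alpha(H)$ is the maximum size of a subset of $V(H)$ which contains no edges of $H$. The degree of a subset $A\subseteq V(H)$ is the number of edges of $H$ containing $A$, and $\Delta_2(H)$ is the maximum degree among $2$-subsets of $V(H)$. Let $$T_2(n,k,3)=\min\{\Delta_2(H): H \text{ is a } 3\text{-graph with } |V(H)|=n,\ \alpha(H)<k\}.$$ The codegree Turán density is $\tau(k,3)=\lim_{n\to\infty}T_2(n,k,3)/(n-2)$; this limit is known to exist. *)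

(* Defs.v *)
From HB Require Import structures.
From mathcomp Require Import all_boot all_order all_algebra.
From mathcomp Require Import all_classical all_reals all_analysis.
Import Order.TTheory GRing.Theory Num.Theory.
Import numFieldNormedType.Exports.

Set Implicit Arguments.
Unset Strict Implicit.
Unset Printing Implicit Defensive.

Local Open Scope ring_scope.

Definition line (d : nat) (p v : 'rV['F_3]_d) : {set 'rV['F_3]_d} :=
  [set p + t *: v | t : 'F_3].

Definition is_cap (d : nat) (S : {set 'rV['F_3]_d}) : bool :=
  [forall p, forall v, (v != 0) ==> (#|S :&: line p v| < 3)%N].

Definition max_cap (d : nat) : nat :=
  (\max_(S : {set 'rV['F_3]_d} | is_cap S) #|S|)%N.

Definition is_3graph (V : finType) (H : {set {set V}}) : bool :=
  [forall e in H, #|e| == 3%N].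

Definition independent (V : finType) (H : {set {set V}}) (A : {set V}) : bool :=
  [forall e in H, ~~ (e \subset A)].

Definition alpha (V : finType) (H : {set {set V}}) : nat :=
  (\max_(A : {set V} | independent H A) #|A|)%N.

Definition degree (V : finType) (H : {set {set V}}) (A : {set V}) : nat :=
  #|[set e in H | A \subset e]|.

Definition Delta2 (V : finType) (H : {set {set V}}) : nat :=
  (\max_(A : {set V} | #|A| == 2%N) degree H A)%N.

Definition complete3 (V : finType) : {set {set V}} :=
  [set e : {set V} | #|e| == 3%N].

(* The minimum of Delta2 over the 3-graphs H on n vertices with alpha H < k.
   The complete 3-graph is only the default witness required by arg min;
   it is admissible as soon as 2 < k, see T2P. *)
Definition T2 (n k : nat) : nat :=
  Delta2 [arg min_(H < complete3 'I_n | is_3graph H && (alpha H < k)%N)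
            Delta2 H].

Lemma complete3_admissible (V : finType) (k : nat) :
  (2 < k)%N -> is_3graph (complete3 V) && (alpha (complete3 V) < k)%N.
Proof.
move=> k2; apply/andP; split.
  by apply/forall_inP => e; rewrite inE.
apply: leq_ltn_trans k2; apply/bigmax_leqP => A /forall_inP indA.
rewrite leqNgt; apply/negP => /card_geqP.
case=> s [us ss sA].
have sE : #|[set x in s]| == 3%N by rewrite cardsE; apply/eqP; rewrite (card_uniqP us).
have := indA [set x in s]; rewrite inE sE => /(_ isT) /negP; apply.
by apply/fintype.subsetP => x; rewrite inE; apply: sA.
Qed.

Lemma T2P (n k : nat) : (2 < k)%N ->
  (exists H : {set {set 'I_n}},
     [/\ is_3graph H, (alpha H < k)%N & Delta2 H = T2 n k]) /\
  (forall H : {set {set 'I_n}},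
     is_3graph H -> (alpha H < k)%N -> (T2 n k <= Delta2 H)%N).
Proof.
move=> k2; rewrite /T2.
case: arg_minnP => [|H /andP[H3 Hk] minH]; first exact: complete3_admissible.
by split=> [|G G3 Gk]; [exists H | apply: minH; rewrite G3].
Qed.

(* The library's lim is total, with value 0 on a divergent real sequence; the
   limit below is known to exist for all k > 2. *)
Definition tau (R : realType) (k : nat) : R :=
  limn (fun n : nat => (T2 n k)%:R / (n%:R - 2) : R).

(* Main.v *)
Require Import Defs.
From HB Require Import structures.
From mathcomp Require Import all_boot all_order all_algebra.
From mathcomp Require Import lra.
From mathcomp Require Import all_classical all_reals all_analysis.

(** Colour the vertices by the points of AG(d,3), as equally as possible, and
    let the edges be the triples of vertices whose colours sum to zero.  Two
    vertices of an edge determine the colour of the third, so every codegree is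
    at most the size of a colour class, about [n / 3 ^ d].  Three vertices of the
    same colour form an edge, since [3 = 0], and so do three vertices whose
    colours are the points of a line.  Hence an independent set has at most two
    vertices of each colour, and its colours form a cap: it has at most
    [2 * max_cap d] vertices.  Dividing by [n - 2] and letting [n] grow gives the
    bound [3 ^- d]. *)

Import Order.TTheory GRing.Theory Num.Theory.
Import numFieldNormedType.Exports.

Set Implicit Arguments.
Unset Strict Implicit.
Unset Printing Implicit Defensive.

Local Open Scope ring_scope.

Lemma mulr3n_rVF3 d (a : 'rV['F_3]_d) : a *+ 3 = 0.
Proof. by rewrite -scaler_nat pchar_Fp_0 // scale0r. Qed.

(** The points [p], [p + v], [p + 2 v] of a line sum to [3 p + 3 v = 0]. *)
Lemma is_cap_zero_sum_free d (S : {set 'rV['F_3]_d}) :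
  (forall a b c, a \in S -> b \in S -> c \in S ->
     a != b -> a != c -> b != c -> a + b + c != 0) ->
  is_cap S.
Proof.
move=> S0; apply/forallP => p; apply/forallP => v; apply/implyP => v0.
rewrite ltnNge; apply/negP => S3.
have lineE : line p v = [set p; p + v; p + v *+ 2].
  apply/setP => x; rewrite !inE; apply/imsetP/idP => [[t _ ->]|].
    case: t => -[|[|[|//]]] i.
    - by rewrite (_ : Ordinal i = 0) ?scale0r ?addr0 ?eqxx //; apply: val_inj.
    - by rewrite (_ : Ordinal i = 1) ?scale1r ?eqxx ?orbT //; apply: val_inj.
    - by rewrite (_ : Ordinal i = 2%:R) ?scaler_nat ?eqxx ?orbT //; apply: val_inj.
  move=> /orP[/orP[]|] /eqP ->.
  - by exists 0; rewrite ?scale0r ?addr0.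
  - by exists 1; rewrite ?scale1r.
  - by exists 2%:R; rewrite ?scaler_nat.
have v2 : v *+ 2 != 0.
  apply: contra_neq v0 => v2.
  by have := mulr3n_rVF3 v; rewrite mulrS v2 addr0.
have cardl : (#|line p v| <= 3)%N.
  apply: leq_trans (leq_imset_card _ _) _.
  by rewrite card_Fp.
have /eqP SlE : S :&: line p v == line p v.
  by rewrite eqEcard subsetIr (leq_trans cardl).
have lS : line p v \subset S by rewrite -SlE subsetIl.
have inS x : x \in [set p; p + v; p + v *+ 2] -> x \in S.
  by rewrite -lineE; apply: (fintype.subsetP lS).
have pv : p != p + v by rewrite -subr_eq0 opprD addNKr oppr_eq0.
have pv2 : p != p + v *+ 2 by rewrite -subr_eq0 opprD addNKr oppr_eq0.
have vv2 : p + v != p + v *+ 2.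
  by rewrite (inj_eq (addrI p)) -subr_eq0 mulr2n opprD addNKr oppr_eq0.
have /eqP[] : p + (p + v) + (p + v *+ 2) != 0.
  by apply: S0 => //; rewrite inS // !inE eqxx ?orbT.
by rewrite (addrA p p) -mulr2n addrACA -mulrSr -mulrS !mulr3n_rVF3 addr0.
Qed.

Section ZeroSumGraph.
Variables (V : finType) (d : nat) (col : V -> 'rV['F_3]_d).

Definition zero_sum_graph : {set {set V}} :=
  [set e : {set V} | (#|e| == 3)%N && (\sum_(x in e) col x == 0)].

Lemma zero_sum_graph_3graph : is_3graph zero_sum_graph.
Proof. by apply/forall_inP => e; rewrite inE => /andP[]. Qed.

Lemma independent_zero_sum (A : {set V}) (x y z : V) :
  independent zero_sum_graph A -> x \in A -> y \in A -> z \in A ->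
  x != y -> x != z -> y != z -> col x + col y + col z != 0.
Proof.
move=> /forall_inP indA xA yA zA xy xz yz; apply/negP => s0.
have xN : x \notin [set y; z] by rewrite !inE negb_or xy.
have yN : y \notin [set z] by rewrite inE.
have /negP[] : ~~ (x |: [set y; z] \subset A).
  apply: indA; rewrite inE cardsU1 xN cardsU1 yN cards1 /=.
  by rewrite !big_setU1 //= big_set1 addrA.
by apply/fintype.subsetP => u; rewrite !inE => /or3P[] /eqP ->.
Qed.

Lemma is_cap_colors (A : {set V}) :
  independent zero_sum_graph A -> is_cap (col @: A).
Proof.
move=> indA; apply: is_cap_zero_sum_free => a b c.
move=> /imsetP[x xA ->{a}] /imsetP[y yA ->{b}] /imsetP[z zA ->{c}] xy xz yz.
apply: (independent_zero_sum indA) => //;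
  [move: xy|move: xz|move: yz]; by apply: contra_neq => ->.
Qed.

Lemma card_color_independent (A : {set V}) (a : 'rV['F_3]_d) :
  independent zero_sum_graph A -> (#|[set x in A | col x == a]| <= 2)%N.
Proof.
move=> indA; rewrite leqNgt; apply/card_gt2P => -[x [y [z]]].
rewrite !inE => -[[/andP[xA /eqP xa] /andP[yA /eqP ya] /andP[zA /eqP za]]].
move=> [xy yz zx].
have xz : x != z by rewrite eq_sym.
have /negP[] := independent_zero_sum indA xA yA zA xy xz yz.
by rewrite xa ya za -addrA -mulr2n -mulrS mulr3n_rVF3.
Qed.

Lemma alpha_zero_sum_graph : (alpha zero_sum_graph <= 2 * max_cap d)%N.
Proof.
apply/bigmax_leqP => A indA.
apply: (@leq_trans (2 * #|col @: A|)); last first.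
  rewrite leq_mul2l /=; apply: leq_bigmax_cond; exact: is_cap_colors.
rewrite -sum1_card (partition_big_imset col) /= mulnC -sum_nat_const.
apply: leq_sum => a _; rewrite sum1_card.
apply: leq_trans (card_color_independent a indA).
by apply/eq_leq/eq_card => x; rewrite inE.
Qed.

(** An edge containing the pair [A] is [A] together with one vertex, of colour
    minus the sum of the colours of [A]. *)
Lemma Delta2_zero_sum_graph m :
  (forall a, #|[set x | col x == a]| <= m)%N -> (Delta2 zero_sum_graph <= m)%N.
Proof.
move=> colm; apply/bigmax_leqP => A /eqP A2.
apply: leq_trans (colm (- \sum_(x in A) col x)).
apply: leq_trans (leq_imset_card (fun z => z |: A) _).
apply/subset_leq_card/fintype.subsetP => e.
rewrite !inE => /andP[/andP[/eqP e3 /eqP e0] Ae].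
have /eqP/cards1P[z eAz] : #|e :\: A| = 1%N by rewrite cardsDS // e3 A2.
have eE : e = z |: A by rewrite -eAz finset.setUC -{1}(finset.setIidPr Ae) finset.setID.
have /setDP[_ zA] : z \in e :\: A by rewrite eAz finset.set11.
apply/imsetP; exists z => //.
by rewrite inE -addr_eq0 -(big_setU1 _ zA) /= -eE e0.
Qed.

End ZeroSumGraph.

(** Colour [i] by its residue modulo [#|T|]; the quotient of [i] by [#|T|] is then
    injective on each colour class. *)
Lemma equitable_coloring (T : finType) (n : nat) : (0 < #|T|)%N ->
  exists col : 'I_n -> T,
    forall t, (#|[set i | col i == t]| <= (n %/ #|T|).+1)%N.
Proof.
move=> T0; exists (fun i => enum_val (Ordinal (ltn_pmod i T0))) => t.
pose f (i : 'I_n) : 'I_(n %/ #|T|).+1 := inord (i %/ #|T|).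
have fE i : f i = (i %/ #|T|)%N :> nat.
  by rewrite inordK // ltnS leq_div2r // ltnW.
rewrite -[X in (_ <= X)%N]card_ord -(@card_in_imset _ _ f); first exact: max_card.
move=> i j; rewrite !inE => /eqP <- /eqP /enum_val_inj /(congr1 val) /= ijm.
move=> /(congr1 val); rewrite /= !fE => ijd; apply: val_inj => /=.
by rewrite (divn_eq i #|T|) (divn_eq j #|T|) ijm ijd.
Qed.

Lemma max_cap_gt0 d : (0 < max_cap d)%N.
Proof.
have cap1 : is_cap [set 0 : 'rV['F_3]_d].
  apply/forallP => p; apply/forallP => v; apply/implyP => _.
  apply: (@leq_ltn_trans #|[set 0 : 'rV['F_3]_d]|); last by rewrite cards1.
  exact/subset_leq_card/subsetIl.
by apply: leq_trans (leq_bigmax_cond _ cap1); rewrite cards1.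
Qed.

Lemma T2_cap_le n d : (T2 n (2 * max_cap d + 1) <= (n %/ 3 ^ d).+1)%N.
Proof.
have cardT : #|{: 'rV['F_3]_d}| = (3 ^ d)%N by rewrite card_mx card_Fp // mul1n.
have T0 : (0 < #|{: 'rV['F_3]_d}|)%N by rewrite cardT expn_gt0.
have [col colP] := equitable_coloring n T0; rewrite cardT in colP.
apply: leq_trans (Delta2_zero_sum_graph colP).
have k2 : (2 < 2 * max_cap d + 1)%N.
  by rewrite addn1 ltnS leq_pmulr // max_cap_gt0.
apply: (T2P n k2).2; first exact: zero_sum_graph_3graph.
by rewrite addn1 ltnS alpha_zero_sum_graph.
Qed.

(** The hypothesis [0 <= c] covers divergent sequences, whose [limn] is the default
    value 0. *)
Lemma limn_le_near (R : realType) (u : nat -> R) (c : R) : 0 <= c ->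
  (forall e, 0 < e -> (\forall n \near \oo, u n <= c + e)%classic) -> limn u <= c.
Proof.
move=> c0 uc; have [cu|/dvgP ->] := pselect (cvgn u); last exact: c0.
by apply/ler_addgt0Pr => e e0; apply: limr_le => //; exact: uc.
Qed.

Theorem mainTheorem5 (R : realType) (d : nat) (hd : (0 < d)%N) :
  tau R (2 * max_cap d + 1)%N <= 3 ^- d.
Proof.
apply: limn_le_near => [|e e0]; first by rewrite invr_ge0 exprn_ge0.
have q0 : 0 < 3 ^+ d :> R by rewrite exprn_gt0.
have qV1 : 3 ^- d <= 1 :> R by rewrite invf_le1 // exprn_ege1 // ler1n.
near=> n.
have n2 : 0 < n%:R - 2 :> R.
  by rewrite subr_gt0; near: n; exact: nbhs_infty_gtr.
rewrite ler_pdivrMr //.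
have T2le : (T2 n (2 * max_cap d + 1))%:R <= n%:R * 3 ^- d + 1 :> R.
  apply: (@le_trans _ _ (n %/ 3 ^ d).+1%:R); first by rewrite ler_nat T2_cap_le.
  rewrite -natr1 lerD2r ler_pdivlMr // -natrX -natrM ler_nat.
  exact: leq_divM.
apply: le_trans T2le _.
(* With [q = 3 ^ d], the claim [n / q + 1 <= (1 / q + e) (n - 2)] amounts to
   [2 / q + 1 <= e (n - 2)], and [2 / q + 1 <= 3]. *)
have : 3 <= e * (n%:R - 2).
  rewrite mulrC -ler_pdivrMr // lerBrDr; near: n; exact: nbhs_infty_ger.
set E := e * _ => E3.
rewrite mulrDl -/E mulrBr [3 ^- d * n%:R]mulrC -addrA lerD2l.
rewrite addrC lerBrDr (le_trans _ E3) //.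
lra.
Unshelve. all: by end_near.
Qed.
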